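(* There is an absolute constant $C$ such that for all integers $n\ge 3$, $$\frac{n}{6} \le g(n,3) \le C\, n\, (\log_2 n)^{\log_2 7}.$$
   Context: For integers $2\le k\le n$, let $S_n$ denote the set of permutations of $[n]=\{1,\dots,n\}$ (written as sequences), and $S_{n,k}$ the set of all sequences of $k$ distinct elements of $[n]$. A sequence $\kappa\in S_{n,k}$ is a subsequence of a permutation $\pi\in S_n$ if its elements appear in $\pi$ in the same relative order as in $\kappa$. A perfect sequence covering array ${\rm PSCA}(n,k)$ with multiplicity $\lambda$ (a positive integer) is a multiset $X$ of elements of $S_n$ such that every $\kappa\in S_{n,k}$ is a subsequence of exactly $\lambda$ elements of $X$ (counted with multiplicity); such an $X$ has size $\lambda k!$. $g(n,k)$ denotes the smallest $\lambda$ for which a ${\rm PSCA}(n,k)$ with multiplicity $\lambda$ exists. *)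

(* Defs.v *)
From mathcomp Require Import all_boot all_fingroup.
From Stdlib Require Import Reals ClassicalEpsilon.

Set Implicit Arguments.
Unset Strict Implicit.
Unset Printing Implicit Defensive.

Definition perm_word (n : nat) (pi : {perm 'I_n}) : seq 'I_n :=
  map pi (enum 'I_n).

Definition is_subseq_of (n k : nat) (kappa : k.-tuple 'I_n) (pi : {perm 'I_n}) : bool :=
  subseq kappa (perm_word pi).

(* X (a multiset of permutations, given as a list) is a PSCA(n,k) with
   multiplicity lam: lam is a positive integer and every kappa in S_{n,k}
   is a subsequence of exactly lam elements of X, counted with multiplicity. *)
Definition is_PSCA (n k lam : nat) (X : seq {perm 'I_n}) : Prop :=
  (0 < lam)%N /\
  forall kappa : k.-tuple 'I_n, uniq kappa ->
    count (is_subseq_of kappa) X = lam.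

Definition has_PSCA (n k lam : nat) : Prop :=
  exists X : seq {perm 'I_n}, is_PSCA k lam X.

(* g(n,k): the smallest lam for which a PSCA(n,k) with multiplicity lam exists
   (chosen by Hilbert's epsilon; it is the minimum whenever a PSCA exists,
   which is always the case for 2 <= k <= n). *)
Definition g (n k : nat) : nat :=
  epsilon (inhabits 0%N)
    (fun m => has_PSCA n k m /\ forall l, has_PSCA n k l -> (m <= l)%N).

Definition log2 (x : R) : R := (ln x / ln 2)%R.

(* Main.v *)
(* Lower bound: fix a point [p]. The vectors (indexed by the permutations of the array)
   recording by a sign whether [a] precedes [p], for [a <> p], together with the
   constant vector, have an explicit positive definite Gram matrix. So these [n]
   vectors are independent, and [n] is at most the size [6 lam] of the array.

   Upper bound: from an array of multiplicity [lam] on a field [F] with [q] elements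
   one gets an array of multiplicity [2 (q + 1) lam] on the affine plane over [F].
   For each of the [q + 1] directions and each ordering [f] of the array, order the
   parallel lines by [f] and the points inside each line by [f], and once more by
   the reverse of [f]. A non-collinear triple is biased only in the three directions
   of its sides, where the third point is never in the middle; these biases cancel.
   Applied with [q = 2^ceil(m/2)], this gives multiplicity at most [2^m 7^j] on
   [2^m] points whenever [m <= 2^j]. *)

Require Import Defs.
From mathcomp Require Import all_boot all_fingroup all_algebra all_field.
From Stdlib Require Import Reals Lra ClassicalEpsilon.
(* [Reals] rebinds [^] on [nat] and the delimiter [%N]; [ssrnat] restores them. *)
From mathcomp Require Import ssrnat zify.

Set Implicit Arguments.
Unset Strict Implicit.
Unset Printing Implicit Defensive.

(* Orderings of [T] are represented by injective rank functions [T -> nat]. For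
   [#|T| <= 2] the triple condition is void, so the size and pair conditions are
   imposed separately. *)
Definition balanced (T : finType) (lam : nat) (X : seq {ffun T -> nat}) : Prop :=
  [/\ size X = 6 * lam,
      forall f : {ffun T -> nat}, f \in X -> injective f,
      forall a b, a != b -> count (fun f : {ffun T -> nat} => f a < f b) X = 3 * lam &
      forall a b c, uniq [:: a; b; c] ->
        count (fun f : {ffun T -> nat} => f a < f b < f c) X = lam].

Lemma count_sum (A : Type) (P : pred A) (s : seq A) :
  count P s = \sum_(x <- s) (P x : nat).
Proof. by rewrite -sumn_count sumnE big_map. Qed.

Lemma balanced_restrict (T T' : finType) (lam : nat) (X : seq {ffun T -> nat})
    (h : T' -> T) :
  injective h -> balanced lam X ->
  balanced lam [seq [ffun x => f (h x)] | f : {ffun T -> nat} <- X].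
Proof.
move=> h_inj [szX injX pairX tripleX]; split.
- by rewrite size_map.
- move=> _ /mapP[f fX ->] x y; rewrite !ffunE => /(injX f fX); exact: h_inj.
- move=> a b ab; rewrite count_map -(pairX (h a) (h b)) ?(inj_eq h_inj) //.
  by apply: eq_count => f /=; rewrite !ffunE.
- move=> a b c abc; rewrite count_map -(tripleX (h a) (h b) (h c)).
    by apply: eq_count => f /=; rewrite !ffunE.
  by rewrite -(map_inj_uniq h_inj) in abc.
Qed.

(** * Lexicographic orderings built from lines and positions *)

Section Lexicographic.

Variables T F : finType.

(** The radix exceeds every value of [g], so the line, ranked by [f], decides first, and [g] on the
    positions breaks ties. *)
Definition lex (l p : T -> F) (f g : {ffun F -> nat}) : {ffun T -> nat} :=
  [ffun x => f (l x) * (\max_y g y).+1 + g (p x)].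

Definition flip (f : {ffun F -> nat}) : {ffun F -> nat} :=
  [ffun x => \max_y f y - f x].

Lemma lex_lt l p (f g : {ffun F -> nat}) u v : injective f ->
  (lex l p f g u < lex l p f g v) =
  if l u == l v then g (p u) < g (p v) else f (l u) < f (l v).
Proof.
move=> f_inj; rewrite !ffunE.
have gu : g (p u) <= \max_y g y by apply: leq_bigmax.
have gv : g (p v) <= \max_y g y by apply: leq_bigmax.
case: eqVneq => [->|luv]; first by rewrite ltn_add2l.
have : f (l u) != f (l v) by rewrite (inj_eq f_inj).
by move: gu gv; nia.
Qed.

Lemma flip_lt (f : {ffun F -> nat}) x y : (flip f x < flip f y) = (f y < f x).
Proof.
rewrite !ffunE.
have : f x <= \max_y f y by apply: leq_bigmax.
have : f y <= \max_y f y by apply: leq_bigmax.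
lia.
Qed.

Lemma flip_inj (f : {ffun F -> nat}) : injective f -> injective (flip f).
Proof.
move=> f_inj x y fxy; apply: f_inj.
by have := flip_lt f x y; have := flip_lt f y x; rewrite fxy ltnn; lia.
Qed.

Lemma lex_inj l p (f g : {ffun F -> nat}) :
  injective (fun x => (l x, p x)) -> injective f -> injective g ->
  injective (lex l p f g).
Proof.
move=> lp_inj f_inj g_inj u v uv; apply: lp_inj.
have := lex_lt l p g u v f_inj; have := lex_lt l p g v u f_inj.
rewrite uv ltnn eq_sym; case: eqVneq => [->|luv] h1 h2.
  by congr (_, _); apply: g_inj; lia.
by case/eqP: luv; apply: f_inj; lia.
Qed.

Variables (D : finType) (l p : D -> T -> F).
Hypothesis lp_inj : forall d, injective (fun x => (l d x, p d x)).
Hypothesis line_unique : forall u v, u != v -> \sum_d (l d u == l d v) = 1.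

Definition blowup (X : seq {ffun F -> nat}) : seq {ffun T -> nat} :=
  flatten [seq flatten [seq [:: lex (l d) (p d) f f; lex (l d) (p d) f (flip f)]
                       | f <- X] | d <- enum D].

Lemma count_blowup (P : pred {ffun T -> nat}) X :
  count P (blowup X) =
  \sum_d \sum_(f <- X)
    (P (lex (l d) (p d) f f) + P (lex (l d) (p d) f (flip f))).
Proof.
rewrite count_flatten sumnE 2!big_map big_enum; apply: eq_bigr => d _.
rewrite count_flatten sumnE !big_map; apply: eq_bigr => f _ /=.
by rewrite addn0.
Qed.

(* For three points on lines [x], [y], [z] of one direction: inside a common line
   an ordering and its flip both occur, while a point off the line of the other two
   is never between them. *)
Lemma triple_in_direction lam X d u v w :
  balanced lam X -> uniq [:: u; v; w] ->
  \sum_(f <- X)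
    ((lex (l d) (p d) f f u < lex (l d) (p d) f f v < lex (l d) (p d) f f w)
     + (lex (l d) (p d) f (flip f) u < lex (l d) (p d) f (flip f) v
        < lex (l d) (p d) f (flip f) w))
  + 2 * lam * (l d u == l d w)
  = 2 * lam + lam * (l d u == l d v) + lam * (l d v == l d w).
Proof.
move=> [_ injX pairX tripleX] uvw.
rewrite (eq_big_seq (fun f : {ffun F -> nat} =>
  (((if l d u == l d v then f (p d u) < f (p d v) else f (l d u) < f (l d v)) &&
   (if l d v == l d w then f (p d v) < f (p d w) else f (l d v) < f (l d w))) +
  ((if l d u == l d v then f (p d v) < f (p d u) else f (l d u) < f (l d v)) &&
   (if l d v == l d w then f (p d w) < f (p d v) else f (l d v) < f (l d w))))%N)); last first.
  by move=> f fX /=; rewrite !lex_lt ?flip_lt //; apply: injX.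
have p_neq x y : x != y -> l d x = l d y -> p d x != p d y.
  move=> xy lxy; apply: contraNneq xy => pxy.
  by apply/eqP/(@lp_inj d); rewrite lxy pxy.
(* On a common line, exactly one of [f] and its flip puts [x] before [y], so each [f] satisfying [A]
   is counted once. *)
have same x y : x != y -> l d x = l d y -> forall A : pred {ffun F -> nat},
    \sum_(f <- X) (((f (p d x) < f (p d y)) && A f) + ((f (p d y) < f (p d x)) && A f))
    = count A X.
  move=> xy lxy A; rewrite count_sum; apply: eq_big_seq => f fX.
  have : f (p d x) != f (p d y) by rewrite (inj_eq (injX f fX)) p_neq.
  rewrite neq_ltn; case: (ltngtP (f (p d x)) _) => //; by case: (A f). 
move: (uvw); rewrite /= !inE negb_or andbT => /andP[/andP[uv uw] vw].
case: (eqVneq (l d u) (l d v)) => [luv|luv];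
  case: (eqVneq (l d v) (l d w)) => [lvw|lvw].
- have luw : l d u = l d w by rewrite luv.
  rewrite luw eqxx big_split /=.
  under [X in _ + X + _]eq_bigr do rewrite andbC.
  rewrite -!count_sum !tripleX; first by lia.
    by rewrite /= !inE negb_or andbT !p_neq // eq_sym.
  by rewrite /= !inE negb_or andbT !p_neq.
- have luw : l d u != l d w by rewrite luv.
  rewrite (negbTE luw) (same u v uv luv (fun f => f (l d v) < f (l d w))) pairX //; lia.
- have luw : l d u != l d w by rewrite -lvw.
  rewrite (negbTE luw).
  under eq_bigr do rewrite ![(_ (l d u) < _) && _]andbC.
  rewrite (same v w vw lvw (fun f => f (l d u) < f (l d v))) pairX //; lia.
- case: (eqVneq (l d u) (l d w)) => [luw|luw].
    rewrite big1 => [|f _]; first by lia.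
    by rewrite luw; lia.
  rewrite big_split /= -!count_sum !tripleX; first by lia.
    by rewrite /= !inE negb_or luv luw lvw.
Qed.

(** Summing [triple_in_direction] over [D], each of the three pairs shares a line in exactly one
    direction: the correction is [2 * lam] on the left and [lam + lam] on the right, and it
    cancels. *)
Lemma balanced_blowup lam X :
  balanced lam X -> balanced (2 * #|D| * lam) (blowup X).
Proof.
move=> balX; have [szX injX pairX tripleX] := balX.
rewrite -mulnA; set N := (X in 2 * X).
have sumD c : \sum_(d : D) c * lam = c * N.
  by rewrite sum_nat_const mulnCA; congr (_ * (_ * _)); apply: eq_card.
have sumX c : \sum_(f <- X) c = 6 * lam * c.
  by rewrite big_const_seq count_predT iter_addn szX addn0 mulnC.
split.
- rewrite -(count_predT (blowup X)) count_blowup /=.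
  rewrite (eq_bigr (fun=> 12 * lam)) => [|d _].
    rewrite sumD; lia.
  by rewrite sumX; lia.
- move=> h /flattenP[_ /mapP[d _ ->] /flattenP[s /mapP[f fX ->]]].
  have f_inj := injX f fX; rewrite !inE => /orP[] /eqP->; apply: lex_inj => //.
  exact: flip_inj.
- move=> u v uv; rewrite count_blowup (eq_bigr (fun=> 6 * lam)) => [|d _].
    rewrite sumD; lia.
  rewrite (eq_big_seq (fun f : {ffun F -> nat} =>
    ((if l d u == l d v then f (p d u) < f (p d v) else f (l d u) < f (l d v))
    + (if l d u == l d v then f (p d v) < f (p d u) else f (l d u) < f (l d v)))%N));
    last by move=> f fX /=; rewrite !lex_lt ?flip_lt //; apply: injX.
  case: eqVneq => [luv|luv]; last first.
    rewrite big_split /= -!count_sum !pairX //; lia.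
  rewrite (eq_big_seq (fun=> 1)) => [|f fX]; first by rewrite sumX; lia.
  have : f (p d u) != f (p d v).
    rewrite (inj_eq (injX f fX)); apply: contraNneq uv => puv.
    by apply/eqP/(@lp_inj d); rewrite luv puv.
  by case: ltngtP.
- move=> u v w uvw; rewrite count_blowup.
  move: (uvw); rewrite /= !inE negb_or andbT => /andP[/andP[uv uw] vw].
  have := eq_bigr _ (fun d (_ : xpredT d) => triple_in_direction d balX uvw).
  move/(_ 0 addn (index_enum D)).
  rewrite big_split [RHS]big_split [X in _ = X + _]big_split /= sumD -!big_distrr /=.
  rewrite !line_unique //; lia.
Qed.

End Lexicographic.

(** * The affine plane over a finite field *)

Section AffinePlane.

Import GRing.Theory.
Local Open Scope ring_scope.

Variable F : finFieldType.

(** [Some a] stands for slope [a], its lines being named by their intercepts; [None] is the vertical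
    direction. *)
Definition line (d : option F) (x : F * F) : F :=
  if d is Some a then x.2 - a * x.1 else x.1.

Definition position (d : option F) (x : F * F) : F :=
  if d is Some _ then x.1 else x.2.

Lemma line_position_inj (d : option F) : injective (fun x => (line d x, position d x)).
Proof.
case: d => [a|] [x1 x2] [y1 y2] [] /=; last by move=> -> ->.
by move=> + e; rewrite e => /addIr ->.
Qed.

Lemma line_unique_direction (u v : F * F) : u != v ->
  (\sum_(d : option F) (line d u == line d v) = 1)%N.
Proof.
case: u v => [u1 u2] [v1 v2] uv.
rewrite (bigD1 None) //= (reindex_omap some (fun d => d)) /=; last by case.
rewrite (eq_bigl xpredT) => [|a]; last by rewrite eqxx.
case: (eqVneq u1 v1) uv => [-> uv|uv1 _].
  rewrite big1 // => a _; case: eqVneq => // e.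
  by rewrite (addIr _ e) eqxx in uv.
have uv0 : u1 - v1 != 0 by rewrite subr_eq0.
have slope a : (u2 - a * u1 == v2 - a * v1) = (a == (u2 - v2) / (u1 - v1)).
  rewrite [RHS]eq_sym (can2_eq (divfK uv0) (mulfK uv0)) mulrBr !subr_eq.
  by congr (_ == _); rewrite addrAC [RHS]addrAC [v2 + _]addrC.
rewrite (bigD1 ((u2 - v2) / (u1 - v1))) //= slope eqxx big1 => [|a /negbTE na].
  by [].
by rewrite slope na.
Qed.

End AffinePlane.

(** * Iterating the plane construction *)

Definition has_balanced (n lam : nat) : Prop :=
  exists X : seq {ffun 'I_n -> nat}, balanced lam X.

Lemma has_balanced_plane (F : finFieldType) n lam :
  n <= #|F| ^ 2 -> has_balanced #|F| lam -> has_balanced n (2 * #|F|.+1 * lam).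
Proof.
move=> n_le [X balX].
have := balanced_blowup (@line_position_inj F) (@line_unique_direction F)
  (balanced_restrict (@enum_rank_inj F) balX).
rewrite card_option => balY.
have n_le' : n <= #|{: F * F}|.
  by rewrite card_prod mulnn.

exists [seq [ffun i => f (enum_val (widen_ord n_le' i))]
       | f : {ffun F * F -> nat} <- blowup (@line F) (@position F)
         [seq [ffun x => f (enum_rank x)] | f : {ffun 'I_#|F| -> nat} <- X]].
apply: balanced_restrict balY => i j /enum_val_inj /(congr1 val) /= ij.
exact: val_inj.
Qed.

Lemma has_balanced2 : has_balanced 2 1.
Proof.
pose f : {ffun 'I_2 -> nat} := [ffun i => val i].
have f_inj : injective f by move=> i j; rewrite !ffunE; apply: val_inj.
exists [:: f; f; f; flip f; flip f; flip f]; split=> //.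
- have ff_inj := flip_inj f_inj.
  by move=> h; rewrite !inE; do ?[case/orP]; move/eqP=> ->.
- move=> a b ab; rewrite /= !flip_lt.
  have : f a != f b by rewrite (inj_eq f_inj).
  by case: ltngtP.
- move=> a b c /card_uniqP abc.
  by have := max_card [in [:: a; b; c]]; rewrite abc card_ord.
Qed.

(** Induction on [j], halving the exponent: the plane over the field with [q = 2 ^ k] elements, [k]
    being [m / 2] rounded up, has at least [2 ^ m] points. *)
Lemma has_balanced_pow2 j m : 0 < m <= 2 ^ j ->
  exists2 lam, 0 < lam <= 2 ^ m * 7 ^ j & has_balanced (2 ^ m) lam.
Proof.
elim: j m => [|j IHj] m /andP[m_gt0 m_le].
  have -> : m = 1 by move: m_le; rewrite expn0; lia.
  by exists 1; last exact: has_balanced2.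
pose k := uphalf m.
have m_half : m <= k.*2 <= m.+1.
  by rewrite /k; have := odd_double_half m; rewrite uphalf_half; lia.
have k_gt0 : 0 < k by lia.
have k_le : k <= 2 ^ j by move: m_le; rewrite expnS; lia.
have [|lam /andP[lam_gt0 lam_le] bal] := IHj k; first by rewrite k_gt0.
have [F _ cardF] := pPrimePowerField (isT : prime 2) k_gt0.
rewrite -cardF in bal lam_le.
exists (2 * #|F|.+1 * lam); last first.
  apply: has_balanced_plane bal.
  by rewrite cardF -expnM leq_exp2l //; lia.
rewrite !muln_gt0 lam_gt0 /=.
have F2 : 2 <= #|F| by rewrite cardF -{1}[2]expn1 leq_exp2l.
have FF : #|F| * #|F| <= 2 * 2 ^ m.
  by rewrite cardF -expnD -expnS leq_exp2l //; lia.
rewrite [7 ^ _]expnS.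
(* As [q >= 2], [2 * (q + 1) <= 3 * q]; rounding up [k] costs [q ^ 2 <= 2 * 2 ^ m]. The total factor
   6 fits under the new 7. *)
apply: (@leq_trans (2 * #|F|.+1 * (#|F| * 7 ^ j))); first by rewrite leq_mul.
apply: (@leq_trans (3 * #|F| * (#|F| * 7 ^ j))); first by rewrite leq_mul //; lia.
apply: (@leq_trans (3 * (2 * 2 ^ m) * 7 ^ j)).
  by rewrite mulnA leq_mul // -mulnA leq_mul.
by move: (2 ^ m) (7 ^ j) => x y; nia.
Qed.

(** * The lower bound *)

Section LowerBound.

Import GRing.Theory Num.Theory.
Local Open Scope ring_scope.

Variables (T : finType) (lam : nat) (X : seq {ffun T -> nat}).
Hypotheses (lam_gt0 : (0 < lam)%N) (balX : balanced lam X).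

(* Fixing [p], the vectors [f |-> sign_vector f a] have Gram matrix
   [4 lam I + 2 lam B], where [B] is block diagonal with two all-ones blocks,
   on [{p}] and on its complement. *)
Definition sign_vector (p : T) (f : {ffun T -> nat}) (a : T) : rat :=
  if a == p then 1 else (2 * (f a < f p)%N)%:R - 1.

Lemma sum_count (P : pred {ffun T -> nat}) :
  \sum_(f <- X) ((P f : nat)%:R : rat) = (count P X)%:R.
Proof. by rewrite count_sum raddf_sum. Qed.

(** Either [a] or [b] comes first, and each case is a triple condition. *)
Lemma count_both_before a b p : a != p -> b != p -> a != b ->
  count (fun f : {ffun T -> nat} => (f a < f p)%N && (f b < f p)%N) X = (2 * lam)%N.
Proof.
have [szX injX pairX tripleX] := balX.
move=> ap bp ab.
have abp : uniq [:: a; b; p] by rewrite /= !inE negb_or ab ap bp.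
have bap : uniq [:: b; a; p] by rewrite /= !inE negb_or eq_sym ab ap bp.
rewrite mul2n -addnn -{1}(tripleX _ _ _ abp) -(tripleX _ _ _ bap) !count_sum.
rewrite -big_split /=; apply: eq_big_seq => f fX.
have : f a != f b by rewrite (inj_eq (injX f fX)).
case: (ltngtP (f a) (f b)) => //=; lia.
Qed.

Lemma gram_sign_vector p a b :
  \sum_(f <- X) sign_vector p f a * sign_vector p f b =
  (4 * lam * (a == b) + 2 * lam * ((a == p) == (b == p)))%:R.
Proof.
have [szX injX pairX tripleX] := balX.
have one : \sum_(f <- X) (1 : rat) = (6 * lam)%:R.
  by rewrite -szX -(count_predT X) -sum_count.
have pair c : c != p ->
    \sum_(f <- X) ((f c < f p)%N%:R : rat) = (3 * lam)%:R.
  by move=> cp; rewrite sum_count pairX.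
have single c : c != p ->
    \sum_(f <- X) ((2 * (f c < f p)%N)%:R - 1 : rat) = 0.
  move=> cp; rewrite big_split /= sumrN one.
  under eq_bigr do rewrite natrM.
  by rewrite -big_distrr /= pair // -natrM mulnA subrr.
rewrite /sign_vector.
have [->|ap] := eqVneq a p; have [ebp|bp] := eqVneq b p.
- under eq_bigr do rewrite mulr1.
  by rewrite one; congr _%:R; lia.
- under eq_bigr do rewrite mul1r.
  by rewrite single // !muln0.
- under eq_bigr do rewrite mulr1.
  by rewrite single // ebp (negbTE ap) !muln0.
have [->|ab] := eqVneq a b.
  rewrite (eq_bigr (fun=> 1)) => [|f _]; first by rewrite one; congr _%:R; lia.
  case: (f b < f p)%N; first by rewrite muln1 addrK mulr1.
  by rewrite muln0 sub0r mulrNN mulr1.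
(* Expansion of [(2x - 1)(2y - 1)]; the sum is [8 lam - 6 lam - 6 lam + 6 lam]. *)
rewrite (eq_bigr (fun f : {ffun T -> nat} =>
  4 * ((f a < f p)%N && (f b < f p)%N)%:R - 2 * (f a < f p)%N%:R
    - 2 * (f b < f p)%N%:R + 1)) => [|f _]; last first.
  by case: (f a < f p)%N; case: (f b < f p)%N => /=.
rewrite !big_split /= !sumrN -!big_distrr /= !pair // one sum_count.
rewrite count_both_before //.
have -> : (6 * lam)%:R = 2 * (3 * lam)%:R :> rat by rewrite -natrM mulnA.
rewrite subrK -!natrM -natrB; last by lia.
by congr _%:R; lia.
Qed.

(** A kernel vector satisfies [2 w b = - (sum of w over the block of b)]. It is thus constant on
    each block, and then [w b] times 2 plus the block size vanishes. *)
Lemma gram_sign_vector_regular p (w : T -> rat) :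
  (forall b, \sum_a w a * \sum_(f <- X) sign_vector p f a * sign_vector p f b = 0) ->
  forall a, w a = 0.
Proof.
move=> w_ker.
have w_block b : w b *+ 2 = - \sum_a w a * ((a == p) == (b == p))%:R.
  have := w_ker b; under eq_bigr do rewrite gram_sign_vector natrD mulrDr.
  rewrite big_split /= (bigD1 b) //= eqxx muln1 big1 ?addr0 => [|a /negbTE ->];
    last by rewrite muln0 mulr0.
  have -> : \sum_a w a * (2 * lam * ((a == p) == (b == p)))%:R
    = (2 * lam)%:R * \sum_a w a * ((a == p) == (b == p))%:R.
    by rewrite big_distrr; apply: eq_bigr => a _; rewrite natrM mulrCA.
  have -> : w b * (4 * lam)%:R = (2 * lam)%:R * (w b *+ 2).
    by rewrite -[w b *+ 2]mulr_natr mulrCA -natrM; congr (_ * _%:R); lia.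
  rewrite -mulrDr => /eqP; rewrite mulf_eq0 pnatr_eq0 muln_eq0 /= eqn0Ngt lam_gt0 /=.
  by rewrite addr_eq0 => /eqP.
move=> b.
have w_const a : (a == p) == (b == p) -> w a = w b.
  move=> /eqP ab; apply: (@pmulrnI _ 2) => //; rewrite !w_block.
  by under eq_bigr do rewrite ab.
have := w_block b.
rewrite (eq_bigr (fun a => w b * ((a == p) == (b == p))%:R)) => [|a _]; last first.
  by case ab: ((a == p) == (b == p)); rewrite ?mulr0 // (w_const _ ab).
rewrite -big_distrr /= -natr_sum -[w b *+ 2]mulr_natr => /eqP.
rewrite -addr_eq0 -mulrDr -natrD.
by rewrite mulf_eq0 pnatr_eq0 orbF => /eqP.
Qed.

(** If [v M = 0] then [v] kills the Gram matrix [M M^T], so the rows of [M] are independent and at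
    most as many as its [6 * lam] columns. *)
Lemma card_le_size_balanced : (#|T| <= 6 * lam)%N.
Proof.
have [szX _ _ _] := balX.
have [p _|T0] := pickP T; last by rewrite (eq_card0 T0).
pose M : 'M[rat]_(#|T|, size X) :=
  \matrix_(i, j) sign_vector p (tnth (in_tuple X) j) (enum_val i).
suff : row_free M by rewrite -row_leq_rank -szX => /leq_trans; apply; exact: rank_leq_col.
apply: inj_row_free => v vM0; apply/rowP => i; rewrite mxE.
have := @gram_sign_vector_regular p (fun a => v 0 (enum_rank a)).
move=> /(_ _ (enum_val i)); rewrite enum_valK; apply=> b.
have vMM0 : (v *m (M *m M^T)) 0 (enum_rank b) = 0 by rewrite mulmxA vM0 mul0mx mxE.
rewrite -[RHS]vMM0 mxE.
rewrite (reindex_onto enum_val enum_rank) /=; last by move=> a _; exact: enum_rankK.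
apply: eq_big => [j|j _]; first by rewrite enum_valK eqxx.
rewrite enum_valK mxE (big_tnth _ _ X); congr (_ * _).
by apply: eq_bigr => k _; rewrite !mxE enum_rankK.
Qed.

End LowerBound.

(** * Permutations and rank functions *)

(** A strictly sorted sequence is determined by its members, so a sorted [t] is the filter of [s] by
    membership in [t]. *)
Lemma subseq_sorted_rank (T : eqType) (f : T -> nat) (s t : seq T) :
  (forall x, x \in s) -> sorted (relpre f ltn) s ->
  subseq t s = sorted (relpre f ltn) t.
Proof.
move=> s_full s_sorted.
have ltn_f_trans : transitive (relpre f ltn) by move=> x y z; apply: ltn_trans.
have ltn_f_irr : irreflexive (relpre f ltn) by move=> x; apply: ltnn.
apply/idP/idP => [/subseq_sorted|t_sorted]; first exact.
have -> : t = [seq x <- s | x \in t]; last exact: filter_subseq.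
apply: (irr_sorted_eq ltn_f_trans ltn_f_irr) => // [|x].
  exact: sorted_filter.
by rewrite mem_filter s_full andbT.
Qed.

Section PermutationRanks.

Variable n : nat.

Definition perm_rank (pi : {perm 'I_n}) : {ffun 'I_n -> nat} :=
  [ffun a => val ((pi^-1)%g a)].

Lemma is_subseq_of_perm_rank k (kappa : k.-tuple 'I_n) (pi : {perm 'I_n}) :
  is_subseq_of kappa pi = sorted (relpre (perm_rank pi) ltn) kappa.
Proof.
apply: subseq_sorted_rank => [x|].
  by apply/mapP; exists ((pi^-1)%g x); rewrite ?mem_enum // permKV.
rewrite sorted_map (eq_sorted (e' := relpre val ltn)) => [|x y /=].
  by rewrite -sorted_map val_enum_ord iota_ltn_sorted.
by rewrite !ffunE !permK.
Qed.

Definition rank_word (f : {ffun 'I_n -> nat}) : seq 'I_n :=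
  sort (relpre f leq) (enum 'I_n).

(** Taking [i] itself as the default of [nth] avoids choosing a point of ['I_n], which may be empty;
    the default is never reached. *)
Lemma perm_of_rank_subproof (f : {ffun 'I_n -> nat}) :
  injective (fun i : 'I_n => nth i (rank_word f) i).
Proof.
have sz : size (rank_word f) = n by rewrite size_sort size_enum_ord.
move=> i j /eqP; rewrite (set_nth_default j) ?sz //.
by rewrite nth_uniq ?sz // ?sort_uniq ?enum_uniq // => /eqP/val_inj.
Qed.

Definition perm_of_rank (f : {ffun 'I_n -> nat}) : {perm 'I_n} :=
  perm (@perm_of_rank_subproof f).

Lemma perm_word_perm_of_rank (f : {ffun 'I_n -> nat}) :
  perm_word (perm_of_rank f) = rank_word f.
Proof.
have sz : size (rank_word f) = n by rewrite size_sort size_enum_ord.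
have szw : size (perm_word (perm_of_rank f)) = n by rewrite size_map size_enum_ord.
have [n0|n_gt0] := posnP n.
  by rewrite (size0nil (etrans sz n0)) (size0nil (etrans szw n0)).
pose x0 : 'I_n := Ordinal n_gt0.
apply: (@eq_from_nth _ x0); rewrite ?szw ?sz // => i i_lt.
rewrite (nth_map x0) ?size_enum_ord // permE nth_enum_ord //.
by apply: set_nth_default; rewrite sz.
Qed.

Lemma is_subseq_of_perm_of_rank k (kappa : k.-tuple 'I_n) (f : {ffun 'I_n -> nat}) :
  injective f ->
  is_subseq_of kappa (perm_of_rank f) = sorted (relpre f ltn) kappa.
Proof.
move=> f_inj; rewrite /is_subseq_of perm_word_perm_of_rank.
apply: subseq_sorted_rank => [x|]; first by rewrite mem_sort mem_enum.
rewrite -sorted_map ltn_sorted_uniq_leq map_inj_uniq // sort_uniq enum_uniq.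
by rewrite sorted_map sort_sorted // => x y; apply: leq_total.
Qed.

Lemma is_PSCA_perm_of_rank lam (X : seq {ffun 'I_n -> nat}) :
  0 < lam -> balanced lam X -> is_PSCA 3 lam [seq perm_of_rank f | f <- X].
Proof.
move=> lam_gt0 [_ injX _ tripleX]; split=> // -[[|a [|b [|c [|]]]] //= sz3] abc.
rewrite count_map -(tripleX a b c) //; apply: eq_in_count => f fX.
by rewrite /= (is_subseq_of_perm_of_rank _ (injX f fX)) /= andbT.
Qed.

(** Since [n > 2], a pair has a third point [c]; its three possible places relative to the pair give
    the count [3 * lam]. The two orders of one pair then give the size. *)
Lemma balanced_perm_rank lam (X : seq {perm 'I_n}) :
  2 < n -> is_PSCA 3 lam X -> balanced lam [seq perm_rank pi | pi <- X].
Proof.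
move=> n_gt2 [lam_gt0 tripleX].
have rank_inj pi : injective (perm_rank pi).
  by move=> a b; rewrite !ffunE => /val_inj; apply: perm_inj.
have triple a b c : uniq [:: a; b; c] ->
    count (fun pi => perm_rank pi a < perm_rank pi b < perm_rank pi c) X = lam.
  move=> abc; rewrite -(tripleX [tuple a; b; c]) //; apply: eq_count => pi.
  by rewrite is_subseq_of_perm_rank /= andbT.
have pair a b : a != b ->
    count (fun pi => perm_rank pi a < perm_rank pi b) X = 3 * lam.
  move=> ab; have [c c_ab|c_ab] := pickP [pred c | c \notin [:: a; b]]; last first.
    suff : n <= 2 by lia.
    rewrite -[n]card_ord; apply: leq_trans (card_size [:: a; b]).
    by apply/subset_leq_card/subsetP => c _; have := c_ab c => /= /negbFE.
  move: c_ab; rewrite !inE negb_or => /andP[ca cb].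
  have abc : uniq [:: a; b; c] by rewrite /= !inE negb_or ab !(eq_sym _ c) ca cb.
  have acb : uniq [:: a; c; b] by rewrite /= !inE negb_or ab (eq_sym _ c) ca cb.
  have cab : uniq [:: c; a; b] by rewrite /= !inE negb_or ab ca cb.
  transitivity (lam + lam + lam); last by lia.
  rewrite -{1}(triple _ _ _ abc) -{1}(triple _ _ _ acb) -(triple _ _ _ cab).
  rewrite !count_sum -!big_split /=; apply: eq_bigr => pi _.
  have : perm_rank pi c != perm_rank pi a by rewrite (inj_eq (@rank_inj pi)).
  have : perm_rank pi c != perm_rank pi b by rewrite (inj_eq (@rank_inj pi)).
  case: (ltngtP (perm_rank pi c) (perm_rank pi a)) => //=;
    case: (ltngtP (perm_rank pi c) (perm_rank pi b)) => //=; lia.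
split.
- rewrite size_map; pose a : 'I_n := Ordinal (ltnW (ltnW n_gt2)).
  pose b : 'I_n := Ordinal (ltnW n_gt2); have ab : a != b by []; have ba : b != a by [].
  transitivity (3 * lam + 3 * lam); last by lia.
  rewrite -{1}(pair _ _ ab) -(pair _ _ ba).
  rewrite -[size X](count_predT X) !count_sum -big_split /=; apply: eq_bigr => pi _.
  have : perm_rank pi b != perm_rank pi a by rewrite (inj_eq (@rank_inj pi)).
  by case: ltngtP.
- by move=> _ /mapP[pi _ ->].
- by move=> a b ab; rewrite count_map -(pair a b).
- by move=> a b c abc; rewrite count_map -(triple a b c).
Qed.

End PermutationRanks.

(** * The minimum [g] and the bounds in integers *)

Lemma g_spec n k m : has_PSCA n k m -> has_PSCA n k (g n k) /\ g n k <= m.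
Proof.
move=> Pm.
have least_exists : exists l0, has_PSCA n k l0 /\ forall l, has_PSCA n k l -> l0 <= l.
  (* Epsilon is specified only once a minimum is known to exist; well-founded descent from [m]
     supplies it. *)
  elim/ltn_ind: m Pm => m IHm Pm.
  have [[l [l_lt Pl]]|no_less] := classic (exists l, l < m /\ has_PSCA n k l).
    exact: IHm l_lt Pl.
  exists m; split=> // l Pl; rewrite leqNgt; apply/negP => l_lt.
  by apply: no_less; exists l.
have [Pg g_min] := epsilon_spec (inhabits 0) _ least_exists.
by split; [exact: Pg | exact: g_min].
Qed.

Lemma card_le_6g n : 2 < n -> has_PSCA n 3 (g n 3) -> n <= 6 * g n 3.
Proof.
move=> n_gt2 [X XP]; have [g_gt0 _] := XP.
by have := card_le_size_balanced g_gt0 (balanced_perm_rank n_gt2 XP); rewrite card_ord.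
Qed.

Lemma has_PSCA_upper n : 2 < n ->
  exists2 lam, has_PSCA n 3 lam & lam <= 2 ^ up_log 2 n * 7 ^ up_log 2 (up_log 2 n).
Proof.
move=> n_gt2; set m := up_log 2 n; set j := up_log 2 m.
have n_le : n <= 2 ^ m by apply: up_logP.
have m_gt0 : 0 < m by rewrite lt0n; apply: contraTneq n_le => ->; rewrite -ltnNge ltnW.
have [|lam /andP[lam_gt0 lam_le] [X balX]] := @has_balanced_pow2 j m.
  by rewrite m_gt0 up_logP.
exists lam => //.
have widen_inj : injective (widen_ord n_le).
  by move=> i k /(congr1 val) /= /val_inj.
exists [seq perm_of_rank f | f <- [seq [ffun i => f (widen_ord n_le i)]
                               | f : {ffun 'I_(2 ^ m) -> nat} <- X]].
exact: is_PSCA_perm_of_rank (balanced_restrict widen_inj balX).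
Qed.

(** * Estimates *)

Lemma INR_expn a k : INR (a ^ k) = (INR a ^ k)%R.
Proof. by elim: k => // k IHk; rewrite expnS -multE mult_INR IHk. Qed.

Lemma ln2_gt0 : (0 < ln 2)%R.
Proof. by rewrite -ln_1; apply: ln_increasing; lra. Qed.

Lemma log2_le_of_expn k n : 2 ^ k <= n -> (INR k <= log2 (INR n))%R.
Proof.
move=> /leP /le_INR; rewrite INR_expn => pow_le.
have ln2 := ln2_gt0.
have pow_gt0 : (0 < INR 2 ^ k)%R by apply: pow_lt; rewrite /=; lra.
apply: (Rmult_le_reg_r (ln 2)) => //; rewrite /log2 /Rdiv Rmult_assoc Rinv_l; last lra.
rewrite Rmult_1_r -[2%R]/(INR 2) -ln_pow; last by rewrite /=; lra.
by case: pow_le => [/(ln_increasing _ _ pow_gt0)|->]; [left | right].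
Qed.

(** Source of the exponent [log2 7]: each halving of the exponent of 2 costs a factor 7. *)
Lemma pow7_Rpower j : (7 ^ j = Rpower (2 ^ j) (log2 7))%R.
Proof.
have ln2 := ln2_gt0.
rewrite -!Rpower_pow; [|lra|lra].
rewrite Rpower_mult /Rpower /log2; congr exp; field.
exact: Rgt_not_eq.
Qed.

Lemma expn_up_log_lt p n : 1 < p -> 1 < n -> p ^ (up_log p n) < p * n.
Proof.
move=> p_gt1 n_gt1; have := up_log_gtn p_gt1 n_gt1.
have : 0 < up_log p n by rewrite up_log_gt0 p_gt1 n_gt1.
by case: up_log => // k _ /=; rewrite expnS ltn_pmul2l // ltnW.
Qed.

(** With [m] and [j] the two rounded-up logarithms, [2 ^ m < 2 n], while
    [2 ^ (j - 1) <= m - 1 <= log2 n] gives [7 ^ j <= 7 (log2 n) ^ (log2 7)]. Hence the constant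
    [14 = 2 * 7]. *)
Lemma upper_estimate n : 2 < n ->
  (INR (2 ^ up_log 2 n * 7 ^ up_log 2 (up_log 2 n))
   <= 14 * INR n * Rpower (log2 (INR n)) (log2 7))%R.
Proof.
move=> n_gt2; have n_gt1 := ltnW n_gt2.
have m_bound := expn_up_log_lt (isT : 1 < 2) n_gt1.
have pred_m_lt := up_log_gtn (isT : 1 < 2) n_gt1.
(* Here [n > 2] matters: [m > 1] makes the second logarithm positive, so it can be written
   [j.+1]. *)
have m_gt1 : 1 < up_log 2 n.
  rewrite ltnNge; apply: contraL n_gt2 => m_le1; rewrite -leqNgt.
  exact: leq_trans (up_logP n (isT : 1 < 2)) (leq_pexp2l (isT : 0 < 2) m_le1).
move: (up_log 2 n) m_bound pred_m_lt m_gt1 => m m_bound pred_m_lt m_gt1.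
have j_bound := up_log_gtn (isT : 1 < 2) m_gt1.
have : 0 < up_log 2 m by rewrite up_log_gt0 m_gt1.
case: (up_log 2 m) j_bound => // j /= j_bound _.
have log_ge := log2_le_of_expn (ltnW pred_m_lt).
have pow_j : (2 ^ j.+1 <= 2 * log2 (INR n))%R.
  have : 2 ^ j <= m.-1 by lia.
  by move/leP/le_INR; rewrite INR_expn -[INR 2]/2%R -tech_pow_Rmult; lra.
have pow_gt0 : (0 < 2 ^ j)%R by apply: pow_lt; lra.
have log_gt0 : (0 < log2 (INR n))%R by move: pow_j; rewrite /=; lra.
have log7_ge0 : (0 <= log2 7)%R.
  apply: Rlt_le; apply: Rdiv_lt_0_compat; last exact: ln2_gt0.
  by rewrite -ln_1; apply: ln_increasing; lra.
have pow7 : (7 ^ j.+1 <= 7 * Rpower (log2 (INR n)) (log2 7))%R.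
  have seven : Rpower 2 (log2 7) = 7%R by rewrite -(pow_1 2) -pow7_Rpower pow_1.
  rewrite pow7_Rpower -[X in (_ <= X * _)%R]seven Rpower_mult_distr //; last lra.
  by apply: Rle_Rpower_l => //; split=> //; apply: pow_lt; lra.
have m_real : (INR (2 ^ m) <= 2 * INR n)%R.
  by rewrite -[2%R]/(INR 2) -mult_INR; apply/le_INR/leP/ltnW.
rewrite -multE mult_INR [INR (7 ^ _)]INR_expn.
have -> : INR 7 = 7%R by rewrite /=; lra.
apply: Rle_trans (Rmult_le_compat _ _ _ _ (pos_INR _) _ m_real pow7) _.
  by apply: pow_le; lra.
by right; ring.
Qed.

Theorem theorem2 :
  exists C : R, forall n : nat, (3 <= n)%N ->
    (INR n / 6 <= INR (g n 3))%R /\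
    (INR (g n 3) <= C * INR n * Rpower (log2 (INR n)) (log2 7))%R.
Proof.
exists 14%R => n n_ge3.
have [lam PSCA_lam lam_le] := has_PSCA_upper n_ge3.
have [PSCA_g g_le] := g_spec PSCA_lam.
split.
  have /leP/le_INR := card_le_6g n_ge3 PSCA_g.
  by rewrite -multE mult_INR /=; lra.
apply: Rle_trans (upper_estimate n_ge3).
by apply/le_INR/leP; apply: leq_trans g_le lam_le.
Qed.
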